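(* Let $n\ge 1$. The open cones in $\mathbb{R}^{n\times n}$ on which the tropical eigenpair map $A\mapsto(\lambda(A),x(A))\in\mathbb{R}\times\mathbb{TP}^{n-1}$ is represented by distinct and unique linear functions are all linearly isomorphic to $\mathbb{R}^n\times\mathbb{R}_{>0}^{n(n-1)}$. These cones are indexed by the connected functions $\phi:[n]\to[n]$, so their number is $$\sum_{k=1}^n \frac{n!}{(n-k)!}\cdot n^{n-k-1}.$$ For $n\ge 3$, these cones do not form a fan, that is, two of (the closures of) these cones may intersect in a set that is not a face of both.
   Context: Work in the max-plus algebra $(\mathbb{R},\oplus,\odot)$ with $u\oplus v=\max\{u,v\}$ and $u\odot v=u+v$; $(A\odot x)_i=\max_j(a_{ij}+x_j)$. For $A\in\mathbb{R}^{n\times n}$, a tropical eigenpair is $(\lambda,x)\in\mathbb{R}\times\mathbb{R}^n$ with $A\odot x=\lambda\odot x$ (i.e. $\max_j(a_{ij}+x_j)=\lambda+x_i$ for all $i$). Eigenvectors are considered in $\mathbb{TP}^{n-1}=\mathbb{R}^n/\mathbb{R}(1,\dots,1)$. The eigenvalue $\lambda(A)$ is unique (the maximum cycle mean of the weighted complete directed graph on $[n]$ with weights $a_{ij}$, loops included); for generic $A$ the eigenvector $x(A)\in\mathbb{TP}^{n-1}$ is unique, and the eigenpair map is $A\mapsto(\lambda(A),x(A))$. A function $\phi:[n]\to[n]$, $[n]=\{1,\dots,n\}$, is called connected if its graph (the directed graph with edges $i\to\phi(i)$, $i\in[n]$) is connected as an undirected graph. *)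

(* Defs.v *)
From HB Require Import structures.
From mathcomp Require Import all_boot all_order all_algebra.
From mathcomp Require Import all_classical all_reals topology normedtype.

Set Implicit Arguments.
Unset Strict Implicit.
Unset Printing Implicit Defensive.

Import Order.TTheory GRing.Theory Num.Theory.
Import numFieldNormedType.Exports.

Local Open Scope classical_set_scope.
Local Open Scope ring_scope.
Local Open Scope quotient_scope.

(* The line R(1,...,1) in R^n, as a subgroup. *)
Definition const_vec (R : realType) (n : nat) : {pred 'cV[R]_n} :=
  fun x => [forall i, forall j, x i 0 == x j 0].

Lemma const_vecP (R : realType) (n : nat) (x : 'cV[R]_n) :
  reflect (exists c : R, x = const_mx c) (x \in @const_vec R n).
Proof.
apply: (iffP idP) => [/forallP xc|[c ->]]; last first.
  by apply/forallP => i; apply/forallP => j; rewrite !mxE.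
case: n x xc => [|n] x xc.
  by exists 0; apply/matrixP => -[].
exists (x 0 0); apply/matrixP => i j; rewrite mxE ord1.
by apply/eqP; have /forallP := xc i; apply.
Qed.

Lemma const_vec_zmod_closed (R : realType) (n : nat) :
  zmod_closed (@const_vec R n).
Proof.
split=> [|x y /const_vecP[c ->] /const_vecP[d ->]]; apply/const_vecP.
  by exists 0; apply/matrixP => i j; rewrite !mxE.
by exists (c - d); apply/matrixP => i j; rewrite !mxE.
Qed.

HB.instance Definition _ (R : realType) (n : nat) :=
  GRing.isZmodClosed.Build 'cV[R]_n (@const_vec R n)
    (@const_vec_zmod_closed R n).

(* Tropical projective space TP^{n-1} = R^n / R(1,...,1), as an R-module. *)
Definition TP (R : realType) (n : nat) : Type :=
  Quotient.quot (@const_vec R n : zmodClosed 'cV[R]_n).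

HB.instance Definition _ (R : realType) (n : nat) :=
  GRing.Zmodule.on (TP R n).

Definition tp (R : realType) (n : nat) (x : 'cV[R]_n) : TP R n :=
  \pi_(Quotient.quot (@const_vec R n : zmodClosed 'cV[R]_n)) x.

Definition tp_repr (R : realType) (n : nat) (p : TP R n) : 'cV[R]_n :=
  repr (p : Quotient.quot (@const_vec R n : zmodClosed 'cV[R]_n)).

Lemma tp_reprK (R : realType) (n : nat) : cancel (@tp_repr R n) (@tp R n).
Proof. by move=> p; exact: reprK. Qed.

Lemma tp_eq (R : realType) (n : nat) (x y : 'cV[R]_n) :
  (tp x = tp y) <-> (exists c : R, x - y = const_mx c).
Proof.
split=> [/eqP|/const_vecP xy].
  by rewrite -Quotient.idealrBE => /const_vecP.
by apply/eqP; rewrite -Quotient.idealrBE.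
Qed.

Lemma tpD (R : realType) (n : nat) (x y : 'cV[R]_n) :
  tp (x + y) = tp x + tp y.
Proof. exact: Quotient.pi_add. Qed.

Definition tp_scale (R : realType) (n : nat) (a : R) (p : TP R n) : TP R n :=
  tp (a *: tp_repr p).

Lemma tp_scaleE (R : realType) (n : nat) (a : R) (x : 'cV[R]_n) :
  tp_scale a (tp x) = tp (a *: x).
Proof.
have /tp_eq[c xc] := tp_reprK (tp x).
by apply/tp_eq; exists (a * c); rewrite -scalerBr xc; apply/matrixP => i j;
  rewrite !mxE.
Qed.

Lemma tp_scaleA (R : realType) (n : nat) (a b : R) (p : TP R n) :
  tp_scale a (tp_scale b p) = tp_scale (a * b) p.
Proof. by rewrite -[p]tp_reprK !tp_scaleE scalerA. Qed.

Lemma tp_scale1 (R : realType) (n : nat) : left_id 1 (@tp_scale R n).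
Proof. by move=> p; rewrite -[p]tp_reprK tp_scaleE scale1r. Qed.

Lemma tp_scaleDr (R : realType) (n : nat) :
  right_distributive (@tp_scale R n) +%R.
Proof.
move=> a p q; rewrite -[p]tp_reprK -[q]tp_reprK -tpD !tp_scaleE -tpD.
by rewrite scalerDr.
Qed.

Lemma tp_scaleDl (R : realType) (n : nat) (p : TP R n) :
  {morph (@tp_scale R n)^~ p : a b / a + b}.
Proof. by move=> a b; rewrite -[p]tp_reprK !tp_scaleE -tpD scalerDl. Qed.

HB.instance Definition _ (R : realType) (n : nat) :=
  GRing.Zmodule_isLmodule.Build R (TP R n)
    (@tp_scaleA R n) (@tp_scale1 R n) (@tp_scaleDr R n) (@tp_scaleDl R n).

(* Since i itself is one of the indices j, the starting value of the iterated
   maximum is one of its terms, so this is max_j (a_ij + x_j). *)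
Definition trop_mulmx (R : realType) (n : nat) (A : 'M[R]_n) (x : 'cV[R]_n) :
    'cV[R]_n :=
  \col_i \big[Num.max/A i i + x i 0]_(j < n) (A i j + x j 0).

Definition trop_scale (R : realType) (n : nat) (l : R) (x : 'cV[R]_n) :
    'cV[R]_n :=
  \col_i (l + x i 0).

(* R x TP^{n-1}; the regular module R^o makes it an R-module. *)
Definition eigen_space (R : realType) (n : nat) := (R^o * TP R n)%type.

HB.instance Definition _ (R : realType) (n : nat) :=
  GRing.Lmodule.on (eigen_space R n).

Definition eigenpair (R : realType) (n : nat) (A : 'M[R]_n)
    (q : eigen_space R n) : Prop :=
  exists x : 'cV[R]_n,
    q.2 = tp x /\ trop_mulmx A x = trop_scale q.1 x.

(* At every A in U the eigenpair in R x TP^{n-1} is unique, i.e. the eigenpair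
   map is defined at A, and its value is L A. *)
Definition represented_on (R : realType) (n : nat) (U : set 'M[R]_n)
    (L : 'M[R]_n -> eigen_space R n) : Prop :=
  forall A, U A -> forall q, eigenpair A q <-> q = L A.

Definition open_cone (R : realType) (n : nat) (U : set 'M[R]_n) : Prop :=
  [/\ U !=set0, open U & forall (t : R) A, 0 < t -> U A -> U (t *: A)].

Definition linear_open_cone (R : realType) (n : nat) (U : set 'M[R]_n) :
    Prop :=
  open_cone U /\
  exists L : {linear 'M[R]_n -> eigen_space R n}, represented_on U L.

(* The domains of linearity of the eigenpair map: the open cones, maximal for
   inclusion, on which it is given by a single linear function. *)
Definition eigenpair_cone (R : realType) (n : nat) : set (set 'M[R]_n) :=
  [set U | linear_open_cone U /\
     forall V, linear_open_cone V -> U `<=` V -> V = U].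

Definition connected_fun (n : nat) (phi : {ffun 'I_n -> 'I_n}) : bool :=
  [forall i, forall j,
     connect (fun a b : 'I_n => (phi a == b) || (phi b == a)) i j].

(* Matrices with an eigenpair for which the maximum in every row i is attained
   exactly at j = phi i. *)
Definition cone_of_fun (R : realType) (n : nat) (phi : {ffun 'I_n -> 'I_n}) :
    set 'M[R]_n :=
  [set A | exists (l : R) (x : 'cV[R]_n),
     trop_mulmx A x = trop_scale l x /\
     forall i j, A i j + x j 0 = trop_mulmx A x i 0 <-> j = phi i].

Definition iso_std_cone (R : realType) (n : nat) (U : set 'M[R]_n) : Prop :=
  exists f : {linear 'M[R]_n -> ('rV[R]_n * 'rV[R]_(n * n.-1))%type},
    bijective f /\ f @` U =
      [set p : 'rV[R]_n * 'rV[R]_(n * n.-1) | forall k, 0 < p.2 0 k].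

(* Faces of a polyhedral cone: zero sets on C of linear forms that are
   nonnegative on C; the zero form gives C itself. *)
Definition face (R : realType) (n : nat) (C F : set 'M[R]_n) : Prop :=
  exists l : {linear 'M[R]_n -> R^o},
    (forall A, C A -> 0 <= l A) /\ F = C `&` [set A | l A = 0].

(* Main.v *)
Require Import Defs.
From HB Require Import structures.
From mathcomp Require Import all_boot all_order all_algebra.
From mathcomp Require Import fingroup perm.
From mathcomp Require Import all_classical all_reals topology normedtype.
From mathcomp Require Import lra.

(** Fix a connected [phi]. The equations [a_(i, phi i) + x_(phi i) = l + x_i]
    have a unique solution [(l, x)] in R x TP^(n-1), linear in the entries
    [a_(i, phi i)], and the cone of [phi] is cut out by the remaining [n(n-1)]
    strict inequalities [a_ij + x_j < l + x_i], whose slacks are free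
    coordinates. Comparing a second eigenvector [y] with [x] where [y - x] is
    maximal shows that the eigenpair is unique on this cone. Conversely, if [A]
    has a unique eigenpair, its equality graph contains a connected [phi], and
    raising the entries of [A] on the graph of [phi] moves [A] into the cone of
    [phi]; so every open cone of linearity meets, hence lies in, some cone of
    [phi].

    For the count, exactly [|S| n^(n-1)] self-maps of [n] points send every
    point into [S] eventually. Prescribing the values on a cycle of length [k],
    and dividing by the choice of a base point of the cycle, leaves
    [n!/(n-k)! n^(n-k-1)] connected maps with a cycle of length [k].

    The cones of the constant maps 0 and 1 already violate the fan property. *)

Import Order.TTheory GRing.Theory Num.Theory.
Import numFieldNormedType.Exports.

Set Implicit Arguments.
Unset Strict Implicit.
Unset Printing Implicit Defensive.

(** * Counting connected self-maps *)

Section FunctionalGraphs.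

Local Open Scope nat_scope.
Local Open Scope set_scope.

Variable T : finType.
Implicit Types (f g h : {ffun T -> T}) (S R : {set T}) (a b x y v : T).

Definition hits (f : T -> T) S : bool :=
  [forall x, [exists y in S, fconnect f x y]].

Lemma hitsP (f : T -> T) S :
  reflect (forall x, exists2 y, y \in S & fconnect f x y) (hits f S).
Proof. by apply: (iffP forallP) => H x; have /exists_inP := H x. Qed.

(** Once the points of [R] are made fixed, reaching [a \in R] means that [a] is the first point of
    [R] on the orbit. *)
Definition stopped R (f : T -> T) x := if x \in R then x else f x.

Lemma eq_stopped R (f g : T -> T) :
  {in [predC R], f =1 g} -> stopped R f =1 stopped R g.
Proof. by move=> fg x; rewrite /stopped; case: ifPn => // xR; apply: fg. Qed.

Lemma fconnect_stopped R (f : T -> T) x y :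
  fconnect (stopped R f) x y -> fconnect f x y.
Proof.
apply: connect_sub => {}x {}y /eqP <-; rewrite /stopped.
by case: ifP => // _; apply: fconnect1.
Qed.

Lemma stopped_fixed R (f : T -> T) a y :
  a \in R -> fconnect (stopped R f) a y -> y = a.
Proof.
move=> aR /iter_findex <-; elim: (findex _ _ _) => //= k ->.
by rewrite /stopped aR.
Qed.

Lemma fconnect_total (f : T -> T) x y z :
  fconnect f x y -> fconnect f x z -> fconnect f y z \/ fconnect f z y.
Proof.
move=> /iter_findex <- /iter_findex <-.
have [le|/ltnW le] := leqP (findex f x y) (findex f x z); [left|right];
  by rewrite -(subnK le) iterD; apply: fconnect_iter.
Qed.

Lemma stopped_root_uniq R (f : T -> T) x a b : a \in R -> b \in R ->
  fconnect (stopped R f) x a -> fconnect (stopped R f) x b -> a = b.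
Proof.
move=> aR bR xa xb.
by have [/(stopped_fixed aR)|/(stopped_fixed bR)] := fconnect_total xa xb.
Qed.

Lemma fconnect_stop R (f : T -> T) x y : y \in R -> fconnect f x y ->
  exists2 a, a \in R & fconnect (stopped R f) x a.
Proof.
move=> yR /iter_findex; move: (findex f x y) => k; elim: k x => [|k IH] x.
  by move=> /= ->; exists y.
rewrite iterSr => /IH[a aR fxa].
have [xR|xR] := boolP (x \in R); first by exists x.
exists a => //; apply: connect_trans (fconnect1 _ _) _.
by rewrite {2}/stopped (negbTE xR).
Qed.

Lemma hits_stopped R (f : T -> T) : hits (stopped R f) R = hits f R.
Proof.
apply/hitsP/hitsP => H x; have [y yR xy] := H x.
  by exists y; rewrite ?(fconnect_stopped xy).
exact: fconnect_stop xy.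
Qed.

Lemma hits_eq R (f g : T -> T) :
  {in [predC R], f =1 g} -> hits f R = hits g R.
Proof.
move=> /eq_stopped fg; rewrite -(hits_stopped R f) -(hits_stopped R g) /hits.
by apply: eq_forallb => x; apply: eq_existsb => y; rewrite (eq_fconnect fg).
Qed.

(** If the orbit of [f a] first meets [R] at [a], it runs forever through [a] and points outside
    [R]. Otherwise, when [f] hits [R], every orbit through [a] goes on to another point of [R]. *)
Lemma hitsD1 (f : T -> T) R a : a \in R ->
  hits f (R :\ a) = hits f R && ~~ fconnect (stopped R f) (f a) a.
Proof.
move=> aR; apply/idP/andP => [H|[H faa]].
  split; first by apply/hitsP => x; have [y /setD1P[_ yR] xy] := hitsP _ _ H x;
    exists y.
  apply/negP => faa; have [y /setD1P[ya yR] ay] := hitsP _ _ H a.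
  (* [C] is closed under [f] and meets [R] at most in [a], so the orbit of [a] cannot contain
     [y]. *)
  pose C := [pred z | (z == a) || ((z \notin R) && fconnect (stopped R f) z a)].
  have stepC z : z \in C -> f z \in C.
    have fC w : fconnect (stopped R f) w a -> w \in C.
      move=> wa; rewrite inE wa andbT.
      by have [wR|] := boolP (w \in R); rewrite ?orbT // (stopped_fixed wR wa) eqxx.
    rewrite inE => /orP[/eqP -> |/andP[zR za]]; apply: fC => //.
    have za_neq : z != a by apply: contraNneq zR => ->.
    move: za; rewrite fconnect_eqVf (negbTE za_neq) /=.
    by rewrite {2}/stopped (negbTE zR).
  have : y \in C.
    rewrite -(iter_findex ay); elim: (findex _ _ _) => [|k IH] /=; last exact: stepC.
    by rewrite inE eqxx.
  by rewrite inE (negbTE ya) yR.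
have fa_root x : fconnect f x a -> exists2 y, y \in R :\ a & fconnect f x y.
  move=> xa; rewrite -hits_stopped in H; have [y yR fay] := hitsP _ _ H (f a).
  exists y; first by rewrite !inE yR andbT; apply: contraNneq faa => {2}<-.
  apply: connect_trans xa (connect_trans (fconnect1 f a) _).
  exact: fconnect_stopped fay.
apply/hitsP => x; have [y yR xy] := hitsP _ _ H x.
have [ya|ya] := eqVneq y a; first by apply: fa_root; rewrite -ya.
by exists y; rewrite ?inE ?ya.
Qed.

Definition update f a v : {ffun T -> T} := [ffun x => if x == a then v else f x].

Lemma update_notin f a v R : a \in R -> {in [predC R], update f a v =1 f}.
Proof.
move=> aR x xR; rewrite ffunE; case: eqP => // xa.
by move: xR; rewrite xa inE /= aR.
Qed.

Definition hitting S := [set f : {ffun T -> T} | hits f S].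

(** By [hitsD1], for [a \in R] these are the functions that hit [R] but not [R :\ a]. *)
Definition returning R a :=
  [set f : {ffun T -> T} | hits f R && fconnect (stopped R f) (f a) a].

(* Exchanging [v] with the value [f a], for [a] the point where the orbit of
   [v] first meets [R], turns a free choice of [v] into a free choice of the
   old value [f a]. *)
Lemma sum_returning R :
  0 < #|T| -> \sum_(a in R) #|returning R a| = #|hitting R|.
Proof.
move=> T_gt0; apply/eqP; rewrite -(eqn_pmul2r T_gt0) big_distrl /=; apply/eqP.
pose X a := [set p : {ffun T -> T} * T |
               hits p.1 R && fconnect (stopped R p.1) p.2 a].
have cardX a : a \in R -> #|returning R a| * #|T| = #|X a|.
  move=> aR; rewrite -cardsT -cardsX.
  pose swap (p : {ffun T -> T} * T) := (update p.1 a p.2, p.1 a).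
  have swapK : involutive swap.
    move=> [f v]; rewrite /swap /= ffunE eqxx; congr pair.
    by apply/ffunP => x; rewrite !ffunE; case: eqP => // ->.
  rewrite -(card_preimset _ (inv_inj swapK)); apply: eq_card => -[f v].
  rewrite !inE /= andbT ffunE eqxx (hits_eq (update_notin f v aR)).
  by rewrite (eq_fconnect (eq_stopped (update_notin f v aR))).
rewrite (eq_bigr _ cardX) -cardsT -cardsX.
under eq_bigr => a _ do rewrite -sum1_card big_mkcond /=.
rewrite exchange_big /= -sum1_card [RHS]big_mkcond /=; apply: eq_bigr => -[f v] _.
rewrite !inE /= andbT; under eq_bigr => a _ do rewrite inE /=.
case: (boolP (hits f R)) => [|_]; last by rewrite big1.
(* The orbit of [v] has exactly one first point in [R], so each pair is counted once. *)
rewrite -hits_stopped => /hitsP/(_ v)[a aR va].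
rewrite (bigD1 a) //= va big1 // => b /andP[bR /eqP ba].
by case: ifP => // vb; case: ba; apply: stopped_root_uniq vb va.
Qed.

Lemma card_hittingD1 R a : a \in R ->
  #|hitting (R :\ a)| + #|returning R a| = #|hitting R|.
Proof.
move=> aR; rewrite addnC.
rewrite -[RHS](cardsID [set f : {ffun T -> T} | fconnect (stopped R f) (f a) a]).
by congr (_ + _); apply: eq_card => f; rewrite !inE ?(hitsD1 _ aR) // andbC.
Qed.

Lemma fconnect_conj (p : {perm T}) (f : T -> T) x y :
  fconnect (fun z => p (f (p^-1%g z))) (p x) (p y) = fconnect f x y.
Proof.
apply/idP/idP => [/iter_findex|/iter_findex <-]; last first.
  elim: (findex _ _ _) => //= k /connect_trans; apply.
  by apply/connect1/eqP; rewrite permK.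
move: (findex _ _ _) => k.
suff -> : iter k (fun z => p (f (p^-1%g z))) (p x) = p (iter k f x).
  by move/perm_inj => <-; apply: fconnect_iter.
by elim: k => //= k ->; rewrite permK.
Qed.

Lemma card_hitting_perm (p : {perm T}) S : #|hitting (p @: S)| = #|hitting S|.
Proof.
pose cj f : {ffun T -> T} := [ffun z => p (f (p^-1%g z))].
pose cj' f : {ffun T -> T} := [ffun z => p^-1%g (f (p z))].
have cjK : cancel cj cj' by move=> f; apply/ffunP => z; rewrite !ffunE !permK.
rewrite -(card_preimset _ (can_inj cjK)); apply: eq_card => f; rewrite !inE.
have cjE : cj f =1 fun z => p (f (p^-1%g z)) by move=> z; rewrite ffunE.
apply/hitsP/hitsP => H x.
  have [_ /imsetP[y yS ->] xy] := H (p x); exists y => //.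
  by rewrite -(fconnect_conj p) -(eq_fconnect cjE).
have [y yS xy] := H (p^-1%g x); exists (p y); first exact: imset_f.
by rewrite -[x](permKV p) (eq_fconnect cjE) fconnect_conj.
Qed.

Lemma card_hittingD1_eq R a b : a \in R -> b \in R ->
  #|hitting (R :\ a)| = #|hitting (R :\ b)|.
Proof.
move=> aR bR; rewrite -(card_hitting_perm (tperm a b)); congr #|hitting _|.
apply/setP => x; rewrite -[x](tpermK a b) mem_imset; last exact: perm_inj.
by rewrite tpermK !inE; case: tpermP => [->|->|/eqP/negbTE -> /eqP/negbTE -> //];
  rewrite ?aR ?bR ?eqxx ?andbT // eq_sym.
Qed.

(** Induction on the complement, from [R = a |: S] down to [S]. By symmetry all [R :\ b] have the
    same number of hitting functions. With h for that count, summing [card_hittingD1] over [b \in R]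
    gives (|S|+1) h(S) + h(R) = (|S|+1) h(R). *)
Lemma card_hitting S : 0 < #|T| -> #|hitting S| = #|S| * #|T| ^ #|T|.-1.
Proof.
move=> T_gt0; move: {2}#|~: S| (erefl #|~: S|) => m.
elim: m S => [|m IH] S cS.
  have -> : S = [set: T].
    apply/setP => x; move/eqP: cS; rewrite cards_eq0 => /eqP/setP/(_ x).
    by rewrite !inE => /negbFE.
  rewrite cardsT -expnS prednK // -card_ffun -cardsT; apply: eq_card => f.
  by rewrite !inE; apply/hitsP => x; exists x; rewrite ?inE.
have [a] : exists a, a \in ~: S by apply/card_gt0P; rewrite cS.
rewrite inE => aS; pose R := a |: S.
have aR : a \in R by apply: setU11.
have SE : S = R :\ a by rewrite setU1K.
have cR : #|R| = #|S|.+1 by rewrite cardsU1 aS.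
have hR : #|hitting R| = #|R| * #|T| ^ #|T|.-1.
  by apply: IH; apply/eqP; rewrite -(eqn_add2l #|R|) cardsC cR addSnnS -cS cardsC.
have : \sum_(b in R) (#|hitting (R :\ b)| + #|returning R b|) =
    \sum_(b in R) #|hitting R|.
  by apply: eq_bigr => b bR; apply: card_hittingD1.
rewrite big_split /= sum_returning //.
under eq_bigr => b bR do rewrite (card_hittingD1_eq bR aR) -SE.
rewrite !sum_nat_const hR cR => E; apply/eqP.
by rewrite -(eqn_pmul2l (ltn0Sn #|S|)) -(eqn_add2r (#|S|.+1 * #|T| ^ #|T|.-1)) E
  -mulnDr addnC -mulSn.
Qed.

(** As [P] ignores the values on [S], all |T|^|S| prescriptions of them occur equally often. *)
Lemma card_fix_values S (P : pred {ffun T -> T}) h : 0 < #|T| ->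
  (forall f g, {in [predC S], f =1 g} -> P f = P g) ->
  #|[set f | P f & [forall x in S, f x == h x]]| * #|T| ^ #|S| =
  #|[set f | P f]|.
Proof.
move=> /card_gt0P[x0 _] PS.
rewrite -(card_pffun_on x0 (mem S) predT) -[X in _ * X]cardsE -cardsX.
pose mix f g : {ffun T -> T} := [ffun x => if x \in S then f x else g x].
(* [dec] splits [f] into its values off [S], completed by [h], and its values on [S], completed by
   the default [x0] as [pffun_on] requires. *)
pose dec f := (mix h f, mix f [ffun=> x0]).
rewrite -(card_imset _ (f := dec)); last first.
  move=> f g /= [/ffunP e1 /ffunP e2]; apply/ffunP => x.
  by have := e1 x; have := e2 x; rewrite !ffunE; case: ifP.
apply: eq_card => -[f g]; rewrite !inE /=; apply/idP/imsetP.
  case/andP => /andP[Pf /forall_inP fh] /pffun_onP[/fintype.subsetP gS _].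
  exists (mix g f).
    rewrite inE -(PS f) // => x; rewrite inE /= ffunE => /negbTE xS.
    by rewrite xS.
  congr pair; apply/ffunP => x; rewrite !ffunE; case: ifP => xS; rewrite ?xS //.
    by rewrite (eqP (fh _ xS)).
  by apply/eqP; apply: contraFT xS => gx; apply: gS.
case=> f'; rewrite inE => Pf' [-> ->]; apply/andP; split; [apply/andP; split|].
- rewrite (PS _ f') // => x; rewrite inE /= ffunE => /negbTE xS.
  by rewrite xS.
- by apply/forall_inP => x xS; rewrite ffunE xS.
apply/pffun_onP; split=> //; apply/fintype.subsetP => x; rewrite inE ffunE /=.
by case: ifP => //; rewrite ffunE eqxx.
Qed.

(** Turns cycling through [t] into prescribed values on [t], the form counted by
    [card_fix_values]. *)
Lemma fcycleE (f : T -> T) (t : seq T) :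
  uniq t -> fcycle f t = [forall x in [set x in t], f x == next t x].
Proof.
move=> Ut; apply/idP/forall_inP => [ft x|H].
  by rewrite inE => xt; exact: (next_cycle ft xt).
rewrite (eq_in_cycle (P := mem t) (e' := frel (next t))) ?cycle_next //.
by move=> x y xt _ /=; rewrite (eqP (H x _)) ?inE.
Qed.

Lemma hits1E (f : T -> T) x : hits f [set x] = [forall y, fconnect f y x].
Proof.
apply: eq_forallb => y; apply/exists_inP/idP => [[z /set1P -> //]|yx].
by exists x; rewrite ?inE.
Qed.

(** The points hit from everywhere, if there are any, form a single cycle. *)
Lemma hits1_connect (f : T -> T) c v : hits f [set c] ->
  hits f [set v] = fconnect f c v.
Proof.
rewrite !hits1E => /forallP Hc; apply/forallP/idP => [/(_ c) //|cv y].
exact: connect_trans (Hc y) cv.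
Qed.

(* A pair consisting of a function and a periodic point of order [k] that
   every point reaches amounts to a sequence of [k] distinct points together
   with a function that cycles through them and hits them from everywhere. *)
Lemma card_rooted_order k : 0 < #|T| -> 0 < k ->
  #|[set p : {ffun T -> T} * T |
       hits p.1 [set p.2] && (fingraph.order p.1 p.2 == k)]|
    * #|T| ^ k = #|T| ^_ k * (k * #|T| ^ #|T|.-1).
Proof.
move=> T_gt0 k_gt0.
pose Y := [set q : {ffun T -> T} * k.-tuple T |
  [&& uniq q.2, hits q.1 [set x in q.2] & fcycle q.1 q.2]].
have [x0 _] := card_gt0P T_gt0.
set X := [set p | _].
have -> : #|X| = #|Y|.
  pose hd (q : {ffun T -> T} * k.-tuple T) := (q.1, head x0 q.2).
  (* The base point determines the tuple, which is the orbit of its own head. *)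
  have orbE f (t : k.-tuple T) : (f, t) \in Y -> orbit f (head x0 t) = t.
    rewrite inE /= => /and3P[Ut _ ft].
    have ht : head x0 t \in (t : seq T).
      have : 0 < size t by rewrite size_tuple.
      by case: (tval t) => //= y s _; apply: mem_head.
    rewrite (orbitE ft Ut ht); suff -> : index (head x0 t) t = 0 by rewrite rot0.
    by case: (tval t) => //= y s; rewrite eqxx.
  have hdinj : {in Y &, injective hd}.
    move=> [f t] [g u] fY gY [fg htu]; congr pair => //; apply: val_inj => /=.
    by rewrite -(orbE _ _ fY) -(orbE _ _ gY) fg htu.
  rewrite -(card_in_imset hdinj); apply: eq_card => -[f v].
  apply/idP/imsetP => [|[[g t] gY [-> ->]]].
    rewrite inE /= => /andP[fv /eqP ov].
    have so : size (orbit f v) == k by rewrite size_orbit ov.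
    have cyc : fcycle f (orbit f v).
      by rewrite -fconnect_f; move: fv; rewrite hits1E => /forallP; apply.
    exists (f, Tuple so); last first.
      by rewrite /hd /=; congr pair; rewrite /orbit -orderSpred.
    rewrite inE /= orbit_uniq cyc andbT; apply/hitsP => x; exists v.
      by rewrite inE in_orbit.
    by move: fv; rewrite hits1E => /forallP.
  have := orbE _ _ gY; move: gY; rewrite !inE /= => /and3P[Ut /hitsP gt ft] ot.
  rewrite -size_orbit ot size_tuple eqxx andbT hits1E; apply/forallP => x.
  have [y] := gt x; rewrite inE => yt xy; apply: connect_trans xy _.
  have ht : head x0 t \in (t : seq T) by have := in_orbit g (head x0 t); rewrite ot.
  by rewrite (fconnect_cycle ft yt).
have -> : #|Y| = \sum_(t : k.-tuple T | uniq t)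
    #|[set f : {ffun T -> T} | hits f [set x in t] & fcycle f t]|.
  rewrite -sum1_card (partition_big snd (fun t : k.-tuple T => uniq t)) /=; last first.
    by move=> [f t]; rewrite inE => /and3P[].
  apply: eq_bigr => t Ut; rewrite sum1dep_card.
  rewrite -[RHS](card_imset _ (f := fun f => (f, t))); last by move=> f g [].
  apply: eq_card => -[f u]; rewrite !inE /=; apply/idP/imsetP => [|[g gt [-> ->]]].
    by case/andP => /and3P[_ hu cu] /eqP <-; exists f; rewrite ?inE ?hu.
  by move: gt; rewrite inE Ut eqxx andbT.
rewrite big_distrl /=.
(* For fixed [t], [card_hitting] counts the functions that hit [t]; prescribing their [k] values on
   [t] divides this count by |T|^k. *)
have cardf (t : k.-tuple T) : uniq t ->
    #|[set f : {ffun T -> T} | hits f [set x in t] & fcycle f t]| * #|T| ^ k =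
    k * #|T| ^ #|T|.-1.
  move=> Ut; have ct : #|[set x in t]| = k.
    by rewrite cardsE (card_uniqP Ut) size_tuple.
  rewrite -[in RHS]ct -card_hitting //.
  have hitsS f g : {in [predC [set x in t]], f =1 g} ->
      hits f [set x in t] = hits g [set x in t] by apply: hits_eq.
  rewrite -(card_fix_values [ffun x => next t x] T_gt0 hitsS) ct.
  congr (_ * _); apply: eq_card => f; rewrite !inE fcycleE //.
  by congr andb; apply: eq_forallb => x; rewrite ffunE.
rewrite (eq_bigr _ cardf) sum_nat_const -cardsE; congr (_ * _).
by rewrite -(card_uniq_tuples k predT); apply: eq_card => t; rewrite !inE all_predT.
Qed.

End FunctionalGraphs.

(** * Connected functions, sorted by the length of their cycle *)

Section ConnectedFunctions.

Local Open Scope nat_scope.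

(** Take [c] reaching the fewest points: a point reachable from [c] reaches no fewer, hence reaches
    [c] too. *)
Lemma exists_recurrent (T : finType) (e : rel T) : 0 < #|T| ->
  exists c, forall d, connect e c d -> connect e d c.
Proof.
move=> /card_gt0P[x0 _].
case: (@arg_minnP T x0 predT (fun x => #|connect e x|)) => // c _ cmin.
exists c => d cd.
have sub : {subset connect e d <= connect e c}.
  by move=> z; rewrite !inE; apply: connect_trans.
have := cmin d isT.
rewrite (geq_leqif (subset_leqif_card _)); last exact/fintype.subsetP.
by move/fintype.subsetP/(_ c); rewrite !inE; apply.
Qed.

(** For a recurrent [c], the property of reaching [c] passes along edges in both directions, so
    connectedness spreads it to all points. *)
Lemma connected_funP (n : nat) (phi : {ffun 'I_n -> 'I_n}) : 0 < n ->
  reflect (exists c, hits phi [set c]%SET) (connected_fun phi).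
Proof.
move=> n_gt0; apply: (iffP forallP) => [H|[c]]; last first.
  rewrite hits1E => /forallP Hc.
  set e := (X in connect X).
  have sym : connect_sym e.
    by apply: sym_connect_sym => x y; rewrite /e orbC.
  have subc x : connect e x c.
    apply: connect_sub (Hc x) => y z /eqP <-.
    by apply: connect1; rewrite /e eqxx.
  move=> i; apply/forallP => j; apply: connect_trans (subc i) _.
  by rewrite sym.
have [|c crec] := @exists_recurrent 'I_n (frel phi); first by rewrite card_ord.
exists c; rewrite hits1E; apply/forallP => y.
suff meet x p : path (fun a b => (phi a == b) || (phi b == a)) x p ->
    fconnect phi x c -> fconnect phi (last x p) c.
  by have /forallP/(_ y)/connectP[p cp ->] := H c; apply: meet cp _.
elim: p x => //= z p IH x /andP[xz zp] xc; apply: IH zp _.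
case/orP: xz => /eqP; last first.
  by move=> zx; apply: connect_trans (fconnect1 _ _) _; rewrite zx.
move=> <-; have [xeq|] := eqVneq x c.
  by rewrite xeq; apply: crec; apply: fconnect1.
by move: xc; rewrite fconnect_eqVf => /predU1P[->|//]; rewrite eqxx.
Qed.

Local Open Scope ring_scope.

(** Weight each pair (f, v), with [v] hit from everywhere, by the inverse of the order of [v]. These
    [v] form the cycle of [f], so a connected [f] has total weight 1. Sorting the pairs by order
    reduces the sum to [card_rooted_order]. *)
Lemma card_connected_fun (n : nat) : (0 < n)%N ->
  #|[set phi | @connected_fun n phi]%SET|%:R =
  \sum_(1 <= k < n.+1)
     (n`!%:R / (n - k)`!%:R) * (n%:R : rat) ^ (n%:Z - k%:Z - 1).
Proof.
move=> n_gt0; have cT : (0 < #|'I_n|)%N by rewrite card_ord.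
pose ord (p : {ffun 'I_n -> 'I_n} * 'I_n) := fingraph.order p.1 p.2.
transitivity (\sum_(p : {ffun 'I_n -> 'I_n} * 'I_n | hits p.1 [set p.2]%SET)
                 (ord p)%:R^-1 : rat).
  rewrite -sum1_card natr_sum big_mkcond /=.
  rewrite -(pair_big_dep predT (fun f v => hits (f : {ffun 'I_n -> 'I_n}) [set v]%SET)
             (fun f v => (ord (f, v))%:R^-1)) /=.
  apply: eq_bigr => f _; rewrite inE.
  have [/(connected_funP _ n_gt0)[c fc]|nconn] := boolP (connected_fun f); last first.
    rewrite big_pred0 // => v; apply/negP => fv.
    by case/negP: nconn; apply/connected_funP => //; exists v.
  have cE v : hits f [set v]%SET -> fconnect f v =1 fconnect f c.
    by move=> fv w; rewrite -(hits1_connect w fc) -(hits1_connect w fv).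
  rewrite (eq_bigr (fun=> (ord (f, c))%:R^-1)); last first.
    by move=> v fv; rewrite /ord /fingraph.order (eq_card (cE v fv)).
  rewrite sumr_const (eq_card (B := fconnect f c)); last first.
    by move=> v; rewrite inE; apply: hits1_connect.
  by rewrite -[RHS]mulr_natl divff // pnatr_eq0 -lt0n fingraph.order_gt0.
have ordn p : (1 <= ord p < n.+1)%N.
  by rewrite fingraph.order_gt0 ltnS -[X in (_ <= X)%N]card_ord max_card.
rewrite (eq_bigr (fun p => \sum_(1 <= k < n.+1 | ord p == k) k%:R^-1)); last first.
  move=> p _; rewrite big_mkcond (bigD1_seq (ord p)) ?iota_uniq ?mem_index_iota //=.
  by rewrite eqxx big1 ?addr0 // => k /negbTE; rewrite eq_sym => ->.
rewrite (exchange_big_dep predT) //= !big_nat; apply: eq_bigr => k /andP[k_gt0 kn].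
have k0 : k%:R != 0 :> rat by rewrite pnatr_eq0 -lt0n.
have n0 : n%:R != 0 :> rat by rewrite pnatr_eq0 -lt0n.
have := card_rooted_order cT k_gt0; rewrite card_ord.
rewrite sumr_const -cardsE; set X := #|_|; set X' := #|_|.
have -> : X' = X by apply: eq_card => p; rewrite !inE.
move=> XE; rewrite -[_ *+ X]mulr_natl.
have kf : (k <= n)%N by rewrite -ltnS.
have f0 : (n - k)`!%:R != 0 :> rat by rewrite pnatr_eq0 -lt0n fact_gt0.
rewrite -(ffact_fact kf) natrM mulfK //.
apply: (mulIf (expf_neq0 k n0)).
rewrite mulrAC -[_ ^+ k]natrX -natrM XE !natrM.
rewrite -!mulrA; congr (_ * _); rewrite mulrCA divff // mulr1.
rewrite !natrX !exprnP -expfzDr // addrAC subrK.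
by congr (_ ^ _); rewrite -subn1 -subzn.
Qed.

End ConnectedFunctions.

(** * Tropical eigenpairs *)

Local Open Scope classical_set_scope.
Local Open Scope ring_scope.

(** Each point other than [c] moves to the next vertex on a shortest path to [c], so its distance
    [d] drops; [c] may take any successor. *)
Lemma exists_fun_to (T : finType) (G : rel T) c :
  (forall i, exists j, G i j) -> (forall i, connect G i c) ->
  exists2 phi : {ffun T -> T}, forall i, G i (phi i) & hits phi [set c]%SET.
Proof.
move=> Gex Gc.
pose P i k := [exists p : k.-tuple T, path G i p && (last i p == c)].
have exP i : exists k, P i k.
  have /connectP[p ip cp] := Gc i; exists (size p).
  by apply/existsP; exists (in_tuple p); rewrite /= ip -cp eqxx.
pose d i := ex_minn (exP i).
have step i : exists j, G i j /\ (i != c -> (d j < d i)%N).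
  have [->|ic] := eqVneq i c; first by have [j] := Gex c; exists j.
  rewrite /d; case: (ex_minnP (exP i)) => k /existsP[[[|j p] kp]] /=.
    by rewrite (negbTE ic).
  move=> /andP[/andP[ij jp] jc] _; exists j; split=> // _.
  case: (ex_minnP (exP j)) => k' _ /(_ (size p)); rewrite -(eqP kp) ltnS; apply.
  by apply/existsP; exists (in_tuple p); rewrite /= jp.
have [f fP] := choice step; exists (finfun f).
  by move=> i; rewrite ffunE; have [] := fP i.
rewrite hits1E; apply/forallP => i; have [k] := ubnP (d i).
elim: k i => // k IH i; rewrite ltnS => dk.
have [-> //|ic] := eqVneq i c; have [_ /(_ ic) df] := fP i.
apply: connect_trans (fconnect1 _ _) (IH _ _); rewrite ffunE.
exact: leq_trans df dk.
Qed.

Section TropicalEigenpairs.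

Variables (R : realType) (n : nat).
Implicit Types (A B D : 'M[R]_n) (x y : 'cV[R]_n) (l m : R)
  (phi psi : {ffun 'I_n -> 'I_n}) (U V : set 'M[R]_n).

Definition is_eigen A l x :=
  (forall i j, A i j + x j 0 <= l + x i 0) /\
  (forall i, exists j, A i j + x j 0 = l + x i 0).

Lemma is_eigenP A l x : trop_mulmx A x = trop_scale l x <-> is_eigen A l x.
Proof.
split=> [/matrixP E|[Ale Aex]].
  have Ei i : \big[Num.max/A i i + x i 0]_(j < n) (A i j + x j 0) = l + x i 0.
    by have := E i 0; rewrite !mxE.
  have Ale i j : A i j + x j 0 <= l + x i 0.
    by rewrite -Ei; apply: (le_bigmax _ (fun j => A i j + x j 0)).
  split=> // i; apply: contrapT => /forallNP H.
  have Alt j : A i j + x j 0 < l + x i 0.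
    by rewrite lt_neqAle Ale andbT; apply/eqP/H.
  suff : \big[Num.max/A i i + x i 0]_(j < n) (A i j + x j 0) < l + x i 0.
    by rewrite Ei ltxx.
  exact: bigmax_lt.
apply/matrixP => i k; rewrite !mxE; apply/eqP; rewrite eq_le; apply/andP; split.
  by apply: bigmax_le.
have [j <-] := Aex i.
exact: (le_bigmax _ (fun j => A i j + x j 0)).
Qed.

Lemma is_eigen_shift A l x c : is_eigen A l x -> is_eigen A l (x + const_mx c).
Proof.
move=> [Ale Aex]; split=> [i j|i]; first by have := Ale i j; rewrite !mxE; lra.
by have [j Aj] := Aex i; exists j; rewrite !mxE; lra.
Qed.

Lemma eigenpairP A l x : eigenpair A (l, tp x) <-> is_eigen A l x.
Proof.
split=> [[y [/= /tp_eq[c xy] /is_eigenP Ay]]|Ax]; last first.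
  by exists x; split=> //; apply/is_eigenP.
by rewrite (_ : x = y + const_mx c); [apply: is_eigen_shift|rewrite -xy addrC subrK].
Qed.

Definition tight A phi l x :=
  (forall i, A i (phi i) + x (phi i) 0 = l + x i 0) /\
  (forall i j, j != phi i -> A i j + x j 0 < l + x i 0).

Lemma tight_eigen A phi l x : tight A phi l x -> is_eigen A l x.
Proof.
move=> [Aphi Alt]; split=> [i j|i]; last by exists (phi i).
by have [->|/Alt/ltW //] := eqVneq j (phi i); rewrite Aphi.
Qed.

Lemma cone_of_funP phi A :
  cone_of_fun phi A <-> exists l x, tight A phi l x.
Proof.
split=> [[l [x [/[dup] Ax /is_eigenP [Ale _] Aphi]]]|[l [x Ax]]]; exists l, x.
  rewrite Ax in Aphi; split=> [i|i j jphi].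
    by have [_ /(_ erefl)] := Aphi i (phi i); rewrite mxE.
  rewrite lt_neqAle Ale andbT; apply: contraNneq jphi => Aij.
  by apply/eqP/Aphi; rewrite mxE.
have /is_eigenP E := tight_eigen Ax; split=> // i j; rewrite E mxE.
have [Aphi Alt] := Ax; split=> [Aij|->]; last exact: Aphi.
by apply/eqP; apply: contraT => /Alt; rewrite Aij ltxx.
Qed.

Lemma exists_argmax (x : 'I_n -> R) : (0 < n)%N ->
  exists i, forall j, x j <= x i.
Proof.
move=> n_gt0.
case: (@Order.TotalTheory.arg_maxP _ _ _ (Ordinal n_gt0) predT x) => // i _ H.
by exists i => j; apply: H.
Qed.

(* Evaluate both eigenvalue equations where [y - x] is maximal. *)
Lemma eigenvalue_le A l m x y : (0 < n)%N ->
  is_eigen A l x -> is_eigen A m y -> m <= l.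
Proof.
move=> n_gt0 [Ax _] [_ Ay].
have [i imax] := exists_argmax (fun i => y i 0 - x i 0) n_gt0.
by have [j Aij] := Ay i; have := Ax i j; have := imax j; lra.
Qed.

Lemma connected_fun_ind phi (P : 'I_n -> Prop) i0 : connected_fun phi ->
  (forall i, P i <-> P (phi i)) -> P i0 -> forall i, P i.
Proof.
move=> /forallP/(_ i0)/forallP H step Pi0 i.
have /connectP[p + ->] := H i; elim: p i0 {H} Pi0 => //= j p IH k Pk /andP[kj].
apply: IH; case/orP: kj => /eqP e; first by rewrite -e -step.
by rewrite step e.
Qed.

(* The set where [y - x] is maximal is closed under [phi] and its inverse. *)
Lemma tight_unique A phi l m x y : (0 < n)%N -> connected_fun phi ->
  tight A phi l x -> is_eigen A m y -> m = l /\ exists c, y - x = const_mx c.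
Proof.
move=> n_gt0 conn Ax Ay; have Ax' := tight_eigen Ax.
have ml : m = l.
  apply/eqP; rewrite eq_le (eigenvalue_le n_gt0 Ax' Ay).
  exact: eigenvalue_le Ay Ax'.
split=> //; have [i imax] := exists_argmax (fun i => y i 0 - x i 0) n_gt0.
exists (y i 0 - x i 0).
suff H j : y j 0 - x j 0 = y i 0 - x i 0.
  by apply/matrixP => j k; rewrite !mxE ord1 H.
move: j; apply: (connected_fun_ind (i0 := i) conn) => // j.
have [Aphi Alt] := Ax; have [Ayle Ayex] := Ay; split=> E; last first.
  by have := imax j; have := Aphi j; have := Ayle j (phi j); lra.
(* An index [k] attaining row [j] for [y] has y_k - x_k at least y_j - x_j, strictly so unless
   [k = phi j]; strictness contradicts maximality. *)
have [k Ajk] := Ayex j; have := imax k.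
have [<-|/Alt] := eqVneq k (phi j); last by lra.
by have := proj1 Ax' j k; lra.
Qed.

Lemma tight_fun_inj A phi psi l m x y : (0 < n)%N -> connected_fun phi ->
  tight A phi l x -> tight A psi m y -> phi = psi.
Proof.
move=> n_gt0 conn Ax Ay.
have [ml [c xy]] := tight_unique n_gt0 conn Ax (tight_eigen Ay).
have yE i : y i 0 = x i 0 + c by move/matrixP/(_ i 0): xy; rewrite !mxE; lra.
apply/ffunP => i; apply/eqP; apply: contraT; rewrite eq_sym => /(proj2 Ax).
by have := proj1 Ay i; rewrite !yE; lra.
Qed.

Lemma cone_of_fun_inj phi psi A : (0 < n)%N -> connected_fun phi ->
  cone_of_fun phi A -> cone_of_fun psi A -> phi = psi.
Proof.
by move=> n_gt0 conn /cone_of_funP[l [x Ax]] /cone_of_funP[m [y Ay]];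
  apply: tight_fun_inj Ax Ay.
Qed.

(** Serves both as a point of the cone of [phi] and as the direction that pushes boundary points
    into it. *)
Definition fun_mx phi : 'M[R]_n := \matrix_(i, j) (j == phi i)%:R.

Lemma tight_perturb A phi l x (e : R) : 0 < e -> is_eigen A l x ->
  (forall i, A i (phi i) + x (phi i) 0 = l + x i 0) ->
  tight (A + e *: fun_mx phi) phi (l + e) x.
Proof.
move=> e_gt0 [Ale _] Aphi; split=> [i|i j /negbTE jphi]; rewrite !mxE.
  by rewrite eqxx mulr1; have := Aphi i; lra.
by rewrite jphi mulr0; have := Ale i j; lra.
Qed.

(* If [c] is recurrent in the graph of equalities, raising [x] slightly on the
   set of points that reach [c] gives another eigenvector; by uniqueness that
   set is everything, and following shortest paths to [c] gives [phi]. *)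
Lemma unique_eigen_connected A l x : (0 < n)%N -> is_eigen A l x ->
  (forall y, is_eigen A l y -> exists c, y - x = const_mx c) ->
  exists2 phi, connected_fun phi &
    forall i, A i (phi i) + x (phi i) 0 = l + x i 0.
Proof.
move=> n_gt0 [Ale Aex] uniq.
pose G : rel 'I_n := fun i j => A i j + x j 0 == l + x i 0.
have [|c crec] := @exists_recurrent 'I_n G; first by rewrite card_ord.
have nextS i : connect G i c -> exists2 j, G i j & connect G j c.
  case/connectP => -[/= _ <-|j p /= /andP[ij jp] ->]; last first.
    by exists j => //; apply/connectP; exists p.
  by have [j /eqP cj] := Aex c; exists j => //; apply: crec; apply: connect1.
have [e e_gt0 egap] : exists2 e, 0 < e & forall i j, ~~ G i j ->
    A i j + x j 0 + e <= l + x i 0.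
  pose gap i j := if G i j then 1 else l + x i 0 - (A i j + x j 0).
  have gap_gt0 i j : 0 < gap i j.
    rewrite /gap; case: ifPn => // /eqP Gij; rewrite subr_gt0 lt_neqAle Ale andbT.
    exact/eqP.
  (* The default 1 keeps the minimum positive even when every pair is an edge of [G]. *)
  exists (\big[Num.min/1]_(ij : 'I_n * 'I_n) gap ij.1 ij.2).
    by apply: lt_bigmin.
  move=> i j Gij; have := bigmin_le 1 (i, j) (fun ij => gap ij.1 ij.2).
  by rewrite /= {2}/gap (negbTE Gij); lra.
pose y := x + \col_i (if connect G i c then e else 0).
have [|d yx] := uniq y.
  split=> [i j|i].
    rewrite !mxE; have := Ale i j; case: ifPn => [jc|_]; last by case: ifP => _; lra.
    have [Gij|/egap] := boolP (G i j); last by case: ifP => _; lra.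
    by rewrite (connect_trans (connect1 Gij) jc); lra.
  (* A point reaching [c] has a [G]-successor that reaches [c] and is raised equally; a point not
     reaching [c] has only unraised [G]-successors. *)
  have [ic|ic] := boolP (connect G i c).
    have [j /eqP ij jc] := nextS i ic.
    by exists j; rewrite !mxE jc ic; lra.
  have [j ij] := Aex i; exists j; rewrite !mxE (negbTE ic).
  case: ifPn => [jc|_]; last by lra.
  by case/negP: ic; apply: connect_trans jc; apply/connect1/eqP.
have allc i : connect G i c.
  have /matrixP/(_ i 0) := yx; have /matrixP/(_ c 0) := yx.
  by rewrite !mxE connect0; case: ifP => // _; lra.
have [|phi Gphi phic] := exists_fun_to _ allc.
  by move=> i; have [j /eqP] := Aex i; exists j.
exists phi => [|i]; last exact/eqP/Gphi.
by apply/connected_funP => //; exists c.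
Qed.

End TropicalEigenpairs.

(** * The linear eigenpair map of a connected function *)

Section LinearSolution.

Variables (R : realType) (n : nat).
Implicit Types (A B D : 'M[R]_n) (phi psi : {ffun 'I_n -> 'I_n}).

(** A maximum of [v] forces [l <= 0] and a minimum forces [l >= 0]; then [v] is constant along the
    connected graph. *)
Lemma shift_fun_trivial phi (v : 'rV[R]_n) (l : R) : connected_fun phi ->
  (forall i, v 0 (phi i) = l + v 0 i) -> forall i j, l = 0 /\ v 0 i = v 0 j.
Proof.
move=> conn vphi i j; have n_gt0 : (0 < n)%N by case: (n) i => [[]|].
have l0 : l = 0.
  have [a amax] := exists_argmax (v 0) n_gt0.
  have [b bmax] := exists_argmax (fun i => - v 0 i) n_gt0.
  have := amax (phi a); have := bmax (phi b); rewrite !vphi; lra.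
split=> //; move: i; apply: (connected_fun_ind (i0 := j) conn) => // i.
by rewrite vphi l0 add0r.
Qed.

(** [u] and [W] are the solution operators: from the entries [b] on the graph of [phi] they give the
    eigenvalue and an eigenvector. *)
Definition solution phi (u : 'cV[R]_n) (W : 'M[R]_n) :=
  forall (b : 'rV[R]_n) i,
    b 0 i + (b *m W) 0 (phi i) = (b *m u) 0 0 + (b *m W) 0 i.

(* The unknowns are [l] and a representative [x] vanishing at [i0], packed into
   one row vector [z] with [z i0 = l]; the right hand sides are [z *m H]. *)
Lemma exists_solution phi : (0 < n)%N -> connected_fun phi ->
  exists u W, solution phi u W.
Proof.
move=> n_gt0 conn; pose i0 := Ordinal n_gt0.
pose e : 'cV[R]_n := delta_mx i0 0.
(* [D] replaces the entry at [i0], which stores the eigenvalue, by 0. *)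
pose D : 'M[R]_n := 1%:M - e *m e^T.
pose H : 'M[R]_n := e *m const_mx 1 + D - D *m (fun_mx R phi)^T.
have HE (z : 'rV[R]_n) i :
    (z *m H) 0 i = (z *m e) 0 0 + (z *m D) 0 i - (z *m D) 0 (phi i).
  have sE : (z *m e *m const_mx 1) 0 i = (z *m e) 0 0.
    by rewrite mxE big_ord1 [const_mx _ _ _]mxE mulr1.
  have yE : (z *m D *m (fun_mx R phi)^T) 0 i = (z *m D) 0 (phi i).
    have PE k : (fun_mx R phi)^T k i = (k == phi i)%:R by rewrite !mxE.
    rewrite mxE (bigD1 (phi i)) //= PE eqxx mulr1 big1 ?addr0 // => k /negbTE kphi.
    by rewrite PE kphi mulr0.
  rewrite mulmxBr mulmxDr !mulmxA -sE -yE.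
  by move: (_ *m const_mx 1) (z *m D) (_ *m _^T) => p q r; rewrite !mxE.
(* A row in the kernel solves the homogeneous equations: its eigenvalue part is 0 and its vector
   part is constant, hence 0 as it vanishes at [i0]. *)
have Hunit : H \in unitmx.
  rewrite -row_free_unit; apply: inj_row_free => z zH0.
  have zphi i : (z *m D) 0 (phi i) = (z *m e) 0 0 + (z *m D) 0 i.
    by have := HE z i; rewrite zH0 [X in X = _]mxE; lra.
  have ze : z *m e = 0.
    apply/matrixP => i j; rewrite !ord1 [RHS]mxE.
    by have [] := shift_fun_trivial conn zphi i0 i0.
  have zD : z = z *m D by rewrite mulmxBr mulmx1 mulmxA ze mul0mx subr0.
  rewrite zD; apply/matrixP => a i; rewrite ord1 [RHS]mxE.
  have [_ ->] := shift_fun_trivial conn zphi i i0; rewrite -zD.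
  by have /matrixP/(_ 0 0) := ze; rewrite /e -colE !mxE.
exists (invmx H *m e), (invmx H *m D) => b i.
by have := HE (b *m invmx H) i; rewrite mulmxKV // !mulmxA; lra.
Qed.

Definition fun_entries phi A : 'rV[R]_n := \row_i A i (phi i).

Definition eigen_map phi (u : 'cV[R]_n) (W : 'M[R]_n) A : eigen_space R n :=
  ((fun_entries phi A *m u) 0 0, tp (fun_entries phi A *m W)^T).

Lemma eigen_map_linear phi u W : linear (eigen_map phi u W).
Proof.
move=> a A B; have eE : fun_entries phi (a *: A + B) =
    a *: fun_entries phi A + fun_entries phi B.
  by apply/matrixP => i j; rewrite !mxE.
rewrite /eigen_map eE !mulmxDl -!scalemxAl; congr pair; first by rewrite !mxE.
by rewrite linearD linearZ /= tpD -tp_scaleE.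
Qed.

HB.instance Definition _ phi u W :=
  GRing.isLinear.Build R 'M[R]_n (eigen_space R n) *:%R (eigen_map phi u W)
    (@eigen_map_linear phi u W).

Lemma solution_entries phi u W A i : solution phi u W ->
  A i (phi i) + (fun_entries phi A *m W)^T (phi i) 0 =
  (fun_entries phi A *m u) 0 0 + (fun_entries phi A *m W)^T i 0.
Proof.
by move=> /(_ (fun_entries phi A) i);
  rewrite ![(_ *m W)^T _ _]mxE [fun_entries _ _ _ _]mxE.
Qed.

(** Two solutions of the equations on the graph differ by a homogeneous one, so the existential in
    the cone can be replaced by explicit linear data. *)
Lemma cone_of_fun_solution phi u W A : (0 < n)%N -> connected_fun phi ->
  solution phi u W ->
  cone_of_fun phi A <->
  tight A phi ((fun_entries phi A *m u) 0 0) (fun_entries phi A *m W)^T.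
Proof.
move=> n_gt0 conn sol; set b := fun_entries phi A; split=> [|?]; last first.
  by apply/cone_of_funP; exists ((b *m u) 0 0), (b *m W)^T.
move=> /cone_of_funP[l [x [Aphi Alt]]].
pose v := b *m W - x^T.
have vE i : v 0 i = (b *m W) 0 i - x i 0.
  by rewrite /v; move: (b *m W) => q; rewrite !mxE.
have bE i : b 0 i = A i (phi i) by rewrite mxE.
have vphi i : v 0 (phi i) = ((b *m u) 0 0 - l) + v 0 i.
  by rewrite !vE; have := sol b i; have := Aphi i; rewrite bE; lra.
have TE i : (b *m W)^T i 0 = (b *m W) 0 i by rewrite mxE.
split=> [i|i j /Alt Aij]; rewrite !TE; first by rewrite -sol bE.
have [lE] := shift_fun_trivial conn vphi i j.
by rewrite !vE; lra.
Qed.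

Lemma eigen_map_represented phi u W : (0 < n)%N -> connected_fun phi ->
  solution phi u W -> represented_on (cone_of_fun phi) (eigen_map phi u W).
Proof.
move=> n_gt0 conn sol A /(cone_of_fun_solution _ n_gt0 conn sol) At q; split.
  case: q => m p [y [/= -> /is_eigenP Ay]].
  have [-> [c yx]] := tight_unique n_gt0 conn At Ay.
  by congr pair; apply/tp_eq; exists c.
by move=> ->; apply/eigenpairP/tight_eigen; exact: At.
Qed.

(** * Open cones of linearity and their maximality *)

Lemma nbhs_perturb (U : set 'M[R]_n) A D : nbhs A U ->
  exists2 e : R, 0 < e & U (A + e *: D).
Proof.
move=> UA; have cA : (A + e *: D) @[e --> (0 : R)] --> A.
  rewrite -[X in _ --> X]addr0 -(scale0r D); apply: cvgD; first exact: cvg_cst.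
  exact: scalel_continuous.
have /nbhs_ballP[d /= d0 dU] := cA _ UA.
exists (d / 2); first by rewrite divr_gt0.
apply: dU; rewrite /ball /= sub0r normrN gtr0_norm ?divr_gt0 //.
by rewrite ltr_pdivrMr // ltr_pMr // ltr1n.
Qed.

Lemma open_perturb (U : set 'M[R]_n) A D : open U -> U A ->
  exists2 e : R, 0 < e & U (A + e *: D).
Proof. by move=> Uo UA; apply: nbhs_perturb; apply: open_nbhs_nbhs. Qed.

(** Any [B] is, up to a positive factor, the difference of two points of [U]. *)
Lemma linear_eq_open (V : lmodType R) (U : set 'M[R]_n)
    (L L' : {linear 'M[R]_n -> V}) : open U -> U !=set0 ->
  (forall A, U A -> L A = L' A) -> L =1 L'.
Proof.
move=> Uo [A UA] LU B; have [e e_gt0 UB] := open_perturb B Uo UA.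
have := LU _ UB; rewrite !linearD !linearZ (LU _ UA) => /addrI.
by apply: scalerI; rewrite gt_eqF.
Qed.

Lemma entry_form_continuous phi (w : 'I_n -> R) i j :
  continuous (fun B : 'M[R]_n => \sum_k B k (phi k) * w k - B i j).
Proof.
move=> A; apply: (@cvgB _ _ _ (nbhs A)); last exact: coord_continuous.
apply: (@cvg_big R _ +%R 0 predT add_continuous _ (nbhs A) _
  (fun k (B : 'M[R]_n) => B k (phi k) * w k)) => k _.
by apply: (@cvgM _ _ (nbhs A)); [exact: coord_continuous | exact: cvg_cst].
Qed.

Lemma cone_of_fun_open phi : (0 < n)%N -> connected_fun phi ->
  open (cone_of_fun phi : set 'M[R]_n).
Proof.
move=> n_gt0 conn; have [u [W sol]] := exists_solution n_gt0 conn.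
rewrite openE => A /(cone_of_fun_solution _ n_gt0 conn sol)[_ At].
pose g i j (B : 'M[R]_n) : R :=
  \sum_k B k (phi k) * (u k 0 + W k i - W k j) - B i j.
have gE i j B : g i j B = (fun_entries phi B *m u) 0 0 +
    (fun_entries phi B *m W)^T i 0 - (B i j + (fun_entries phi B *m W)^T j 0).
  have bW (w : 'cV[R]_n) :
      (fun_entries phi B *m w) 0 0 = \sum_k B k (phi k) * w k 0.
    by rewrite mxE; apply: eq_bigr => k _; rewrite mxE.
  have bT a : (fun_entries phi B *m W)^T a 0 = \sum_k B k (phi k) * W k a.
    by rewrite 2!mxE; apply: eq_bigr => k _; rewrite mxE.
  rewrite bW !bT /g; under eq_bigr => k _ do rewrite mulrBr mulrDr.
  by rewrite sumrB big_split /=; lra.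
have gcont i j : g i j B @[B --> A] --> g i j A.
  exact: entry_form_continuous.
have : \forall B \near A, forall ij : 'I_n * 'I_n,
    ij.2 != phi ij.1 -> 0 < g ij.1 ij.2 B.
  apply: (@filter_forall 'M[R]_n _ _ (nbhs A)) => -[i j] /=.
  have [->|/At gA] := eqVneq j (phi i); first by apply: nearW => B.
  have : 0 < g i j A by rewrite gE; lra.
  by move=> /(cvgr_gt _ (gcont i j)); apply: filterS => B.
apply: filterS => B gB; apply/(cone_of_fun_solution _ n_gt0 conn sol).
split=> [i|i j ij]; last by have := gB (i, j) ij; rewrite /= gE; lra.
exact: solution_entries.
Qed.

Lemma fun_mx_tight phi : tight (fun_mx R phi) phi 1 0.
Proof.
split=> [i|i j /negbTE ij]; rewrite !mxE; first by rewrite eqxx.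
by rewrite ij !addr0 ltr01.
Qed.

Lemma fun_mx_cone phi : cone_of_fun phi (fun_mx R phi).
Proof. by apply/cone_of_funP; exists 1, 0; apply: fun_mx_tight. Qed.

Lemma cone_of_fun_linear phi : (0 < n)%N -> connected_fun phi ->
  linear_open_cone (cone_of_fun phi : set 'M[R]_n).
Proof.
move=> n_gt0 conn; have [u [W sol]] := exists_solution n_gt0 conn.
split; last by exists (eigen_map phi u W); apply: eigen_map_represented.
split; [|exact: cone_of_fun_open|].
  by exists (fun_mx R phi); apply: fun_mx_cone.
move=> t A t_gt0 /cone_of_funP[l [x [Aphi Alt]]].
apply/cone_of_funP; exists (t * l), (t *: x); split=> [i|i j /Alt Aij]; rewrite !mxE.
  by rewrite -!mulrDr Aphi.
by rewrite -!mulrDr ltr_pM2l.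
Qed.

(** Pushing a point of [U] along [fun_mx R phi] shows that [U] meets the cone in a nonempty open
    set, so [L] is [eigen_map]. This yields the weak inequalities on [U], and openness makes them
    strict. *)
Lemma linear_open_cone_sub (U : set 'M[R]_n) : (0 < n)%N ->
  linear_open_cone U ->
  exists2 phi, connected_fun phi & U `<=` cone_of_fun phi.
Proof.
move=> n_gt0 [[[A UA] Uo _] [L LU]].
have [/= x [LA /is_eigenP Ax]] : eigenpair A (L A) by apply/LU.
have [|phi conn Aphi] := unique_eigen_connected n_gt0 Ax.
  move=> y Ay; apply/tp_eq; rewrite -LA.
  by have /(LU _ UA) <- : eigenpair A ((L A).1, tp y) by apply/eigenpairP.
exists phi => //; have [u [W sol]] := exists_solution n_gt0 conn.
have LE : L =1 eigen_map phi u W.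
  apply: (@linear_eq_open _ (U `&` cone_of_fun phi)).
  - by apply: openI => //; apply: cone_of_fun_open.
  - have [e e_gt0 Ue] := open_perturb (fun_mx R phi) Uo UA.
    exists (A + e *: fun_mx R phi); split=> //; apply/cone_of_funP.
    by exists ((L A).1 + e), x; apply: tight_perturb.
  - move=> B [UB CB]; apply/esym/(LU _ UB).
    exact/(eigen_map_represented n_gt0 conn sol CB).
have Ule B i j : U B -> B i j + (fun_entries phi B *m W)^T j 0 <=
    (fun_entries phi B *m u) 0 0 + (fun_entries phi B *m W)^T i 0.
  move=> UB; have /eigenpairP[Ble _] : eigenpair B (eigen_map phi u W B).
    by apply/(LU _ UB).
  exact: Ble.
move=> B UB; apply/(cone_of_fun_solution _ n_gt0 conn sol); split=> [i|i j ij].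
  exact: solution_entries.
(* Raising an entry off the graph of [phi] leaves the linear eigenpair unchanged, so the weak
   inequality after the raise is strict before it. *)
have [e e_gt0 Ue] := open_perturb (delta_mx i j) Uo UB.
have eE : (B + e *: delta_mx i j) i j = B i j + e by rewrite !mxE !eqxx mulr1.
have := Ule _ i j Ue; rewrite eE.
have -> : fun_entries phi (B + e *: delta_mx i j) = fun_entries phi B.
  apply/matrixP => a k; rewrite !mxE.
  by have [->|] := eqVneq k i; rewrite ?[phi _ == _]eq_sym ?(negbTE ij) /= mulr0 addr0.
lra.
Qed.

Lemma cone_of_fun_maximal phi : (0 < n)%N -> connected_fun phi ->
  eigenpair_cone (cone_of_fun phi : set 'M[R]_n).
Proof.
move=> n_gt0 conn; split; first exact: cone_of_fun_linear.
move=> V Vlin CV; have [psi pconn Vpsi] := linear_open_cone_sub n_gt0 Vlin.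
have E : phi = psi.
  apply: (cone_of_fun_inj n_gt0 conn (fun_mx_cone phi)).
  exact/Vpsi/CV/fun_mx_cone.
by apply/seteqP; split=> //; rewrite E.
Qed.

Lemma eigenpair_coneP (U : set 'M[R]_n) : (0 < n)%N ->
  eigenpair_cone U <-> exists2 phi, connected_fun phi & cone_of_fun phi = U.
Proof.
move=> n_gt0; split=> [[Ulin Umax]|[phi conn <-]]; last exact: cone_of_fun_maximal.
have [phi conn Uphi] := linear_open_cone_sub n_gt0 Ulin.
by exists phi => //; apply: Umax => //; apply: cone_of_fun_linear.
Qed.

(* A common linear function would represent the eigenpair map on the union,
   against maximality. *)
Lemma eigenpair_cone_fun_inj (U V : set 'M[R]_n)
    (L L' : {linear 'M[R]_n -> eigen_space R n}) :
  eigenpair_cone U -> eigenpair_cone V ->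
  represented_on U L -> represented_on V L' -> L =1 L' -> U = V.
Proof.
move=> [[[U0 Uo Ucone] _] Umax] [[[V0 Vo Vcone] _] Vmax] LU LV LL.
have UVlin : linear_open_cone (U `|` V).
  split; last first.
    exists L => A [/LU //|/LV H] q; rewrite LL; exact: H.
  split; [by case: U0 => A UA; exists A; left | exact: openU |].
  by move=> t A t_gt0 [/Ucone|/Vcone] H; [left|right]; apply: H.
by rewrite -(Umax _ UVlin (@subsetUl _ _ _)) (Vmax _ UVlin (@subsetUr _ _ _)).
Qed.

(** * Slack coordinates and the standard cone *)

Definition slack phi (u : 'cV[R]_n) (W : 'M[R]_n) A i j : R :=
  (fun_entries phi A *m u) 0 0 + (fun_entries phi A *m W) 0 i
  - (fun_entries phi A *m W) 0 j - A i j.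

(** [lift (phi i)] enumerates the columns other than [phi i], which gives n(n-1) slacks. *)
Definition slack_map phi (u : 'cV[R]_n) (W : 'M[R]_n) A :
    'rV[R]_n * 'rV[R]_(n * n.-1) :=
  (fun_entries phi A,
   mxvec (\matrix_(i < n, k < n.-1) slack phi u W A i (lift (phi i) k))).

Lemma slack_map_linear phi u W : linear (slack_map phi u W).
Proof.
move=> a A B; have eE : fun_entries phi (a *: A + B) =
    a *: fun_entries phi A + fun_entries phi B.
  by apply/matrixP => i j; rewrite !mxE.
have slackE i j :
    slack phi u W (a *: A + B) i j = a * slack phi u W A i j + slack phi u W B i j.
  rewrite /slack eE !mulmxDl -!scalemxAl.
  move: (_ *m W) (_ *m W) (_ *m u) (_ *m u) => p q r s; rewrite !mxE; lra.
rewrite /slack_map eE; congr pair.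
set M := (X in mxvec X).
suff -> : M = a *: (\matrix_(i, k) slack phi u W A i (lift (phi i) k)) +
    \matrix_(i, k) slack phi u W B i (lift (phi i) k) by rewrite linearP.
by apply/matrixP => i k; rewrite !mxE slackE.
Qed.

HB.instance Definition _ phi u W :=
  GRing.isLinear.Build R 'M[R]_n ('rV[R]_n * 'rV[R]_(n * n.-1))%type *:%R
    (slack_map phi u W) (@slack_map_linear phi u W).

Lemma cone_of_funE_slack phi u W A : (0 < n)%N -> connected_fun phi ->
  solution phi u W ->
  cone_of_fun phi A <-> forall i k, 0 < slack phi u W A i (lift (phi i) k).
Proof.
move=> n_gt0 conn sol.
have TE i : (fun_entries phi A *m W)^T i 0 = (fun_entries phi A *m W) 0 i.
  by rewrite mxE.
split=> [/(cone_of_fun_solution _ n_gt0 conn sol)[_ At] i k|H].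
  have := At i (lift (phi i) k); rewrite eq_sym neq_lift !TE /slack => /(_ isT).
  lra.
apply/(cone_of_fun_solution _ n_gt0 conn sol); split=> [i|i j].
  exact: solution_entries.
case: (unliftP (phi i) j) => [k ->|->]; last by rewrite eqxx.
by move=> _; have := H i k; rewrite !TE /slack; lra.
Qed.

Lemma cone_of_fun_iso phi : (0 < n)%N -> connected_fun phi ->
  iso_std_cone (cone_of_fun phi : set 'M[R]_n).
Proof.
move=> n_gt0 conn; have [u [W sol]] := exists_solution n_gt0 conn.
(* The inverse reads the entries on the graph from [p.1] and obtains the others by solving for
   [A i j] in the slack. *)
pose h (p : 'rV[R]_n * 'rV[R]_(n * n.-1)) : 'M[R]_n := \matrix_(i, j)
  if unlift (phi i) j is Some k
  then (p.1 *m u) 0 0 + (p.1 *m W) 0 i - (p.1 *m W) 0 j - vec_mx p.2 i k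
  else p.1 0 i.
have fK : cancel (slack_map phi u W) h.
  move=> A; apply/matrixP => i j; rewrite [LHS]mxE /= mxvecK.
  case: unliftP => [k jE|->]; last by rewrite mxE.
  by rewrite [(\matrix_(_, _) _) _ _]mxE -jE /slack; lra.
have hK : cancel h (slack_map phi u W).
  move=> [b w]; have bE : fun_entries phi (h (b, w)) = b.
    by apply/matrixP => i j; rewrite !mxE unlift_none ord1.
  rewrite /slack_map bE; congr pair; rewrite -[RHS]vec_mxK; congr mxvec.
  apply/matrixP => i k; rewrite [LHS]mxE /slack bE [h _ _ _]mxE liftK /=; lra.
exists (slack_map phi u W); split; first by exists h.
have fE A i k : (slack_map phi u W A).2 0 (mxvec_index i k) =
    slack phi u W A i (lift (phi i) k) by rewrite mxvecE mxE.
apply/seteqP; split=> [_ [A /(cone_of_funE_slack _ n_gt0 conn sol) CA <-] k|p p_gt0].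
  by case/mxvec_indexP: k => i k; rewrite fE.
exists (h p); last exact: hK.
by apply/(cone_of_funE_slack _ n_gt0 conn sol) => i k; rewrite -fE hK.
Qed.

End LinearSolution.

(** * Failure of the fan property *)

Section NotAFan.

Variables (R : realType) (n : nat).

Lemma closure_cone_of_fun (A : 'M[R]_n) (phi : {ffun 'I_n -> 'I_n}) l x :
  is_eigen A l x ->
  (forall i, A i (phi i) + x (phi i) 0 = l + x i 0) ->
  closure (cone_of_fun phi) A.
Proof.
move=> Ax Aphi B /(nbhs_perturb (fun_mx R phi))[e e_gt0 Be].
exists (A + e *: fun_mx R phi); split=> //; apply/cone_of_funP.
by exists (l + e), x; apply: tight_perturb.
Qed.

Lemma connected_const (c : 'I_n) : connected_fun [ffun=> c].
Proof.
have n_gt0 : (0 < n)%N by case: (n) c => [[]|].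
apply/connected_funP => //; exists c; rewrite hits1E; apply/forallP => i.
by apply: connect1; rewrite /= ffunE.
Qed.

(* [S = Q + P] with [Q] and [P] in the closure of the first cone and [S] in
   both closures; a face of the first closure containing [S] contains [Q],
   which is not in the second closure. *)
Lemma const_cones_not_face (i0 i1 i2 : 'I_n) :
  i0 != i1 -> i0 != i2 -> i1 != i2 ->
  let U := @cone_of_fun R n [ffun=> i0] in
  let V := @cone_of_fun R n [ffun=> i1] in
  ~ face (closure U) (closure U `&` closure V).
Proof.
move=> i01 i02 i12 U V [l [l_ge0 lF]].
pose Q : 'M[R]_n := \matrix_(i, j) if (i == i0) && (j == i1) then -1 else 0.
pose P : 'M[R]_n := \matrix_(i, j)
  if [&& i == i0, j != i0 & j != i1] then -1 else 0.
have clU (A : 'M[R]_n) : (forall i j, A i j <= 0) -> (forall i, A i i0 = 0) ->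
    closure U A.
  move=> A_le0 A0; apply: (@closure_cone_of_fun _ _ 0 0); last first.
    by move=> i; rewrite !mxE ffunE A0.
  by split=> [i j|i]; [|exists i0]; rewrite !mxE ?A0 ?addr0.
have QU : closure U Q.
  apply: clU => [i j|i]; rewrite mxE; first by case: ifP => _; lra.
  by rewrite (negbTE i01) andbF.
have PU : closure U P.
  apply: clU => [i j|i]; rewrite mxE; first by case: ifP => _; lra.
  by rewrite eqxx andbF.
have SE i j : (Q + P) i j = if (i == i0) && (j != i0) then -1 else 0.
  rewrite !mxE; have [_|_] := eqVneq i i0; rewrite /= ?addr0 //.
  have [->|_] := eqVneq j i1; last by rewrite add0r andbT.
  by rewrite eq_sym i01 /= addr0.
have SU : closure U (Q + P).
  apply: clU => [i j|i]; rewrite SE; first by case: ifP => _; lra.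
  by rewrite eqxx andbF.
have SV : closure V (Q + P).
  (* Lowering the zero eigenvector by 1 at [i0] makes every row of [Q + P] attain its maximum at
     [i1]. *)
  pose x : 'cV[R]_n := \col_i if i == i0 then -1 else 0.
  have Sx i : (Q + P) i i1 + x i1 0 = 0 + x i 0.
    by rewrite SE !mxE [i1 == i0]eq_sym (negbTE i01) andbT addr0 add0r.
  apply: (@closure_cone_of_fun _ _ 0 x); last by move=> i; rewrite ffunE.
  split=> [i j|i]; last by exists i1.
  rewrite SE !mxE; case: (i == i0) => /=; case: (j == i0) => /=; lra.
have lQ : l Q = 0.
  have [_ lS] : (closure U `&` [set A | l A = 0]) (Q + P) by rewrite -lF.
  have := l_ge0 _ QU; have := l_ge0 _ PU.
  by have := lS; rewrite /= linearD => E; lra.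
have [_ QV] : (closure U `&` closure V) Q by rewrite lF.
(* In the second cone, eliminating [m] and [x] leaves B_(i0,i2) + B_(i2,i1) - B_(i1,i1) < B_(i0,i1).
   For [Q] this reads 0 < -1, and four errors below 1/8 cannot bridge the gap. *)
have [B [/cone_of_funP[m [x [Bphi Blt]]] [_ QB]]] :=
  QV _ (nbhsx_ballx Q (8%:R^-1) ltac:(by rewrite invr_gt0)).
have := Blt i0 i2; rewrite ffunE eq_sym i12 => /(_ isT).
have := Bphi i0; have := Bphi i1; have := Bphi i2; rewrite !ffunE.
have near i j : Q i j - 8%:R^-1 < B i j < Q i j + 8%:R^-1.
  have := QB i j; rewrite /ball /= ltr_norml; lra.
have := near i0 i1; have := near i0 i2; have := near i2 i1; have := near i1 i1.
rewrite !mxE !eqxx [i2 == _]eq_sym [i1 == i0]eq_sym (negbTE i01) (negbTE i02) /=.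
rewrite [i2 == _]eq_sym (negbTE i12) /=.
lra.
Qed.

End NotAFan.

Theorem theorem1p2 (R : realType) (n : nat) (hn : (1 <= n)%N) :
  (* each cone carries exactly one linear function *)
  (forall U : set 'M[R]_n, eigenpair_cone U ->
    exists L : {linear 'M[R]_n -> eigen_space R n},
      represented_on U L /\
      forall L' : {linear 'M[R]_n -> eigen_space R n},
        represented_on U L' -> L' =1 L)
  /\
  (* different cones carry different linear functions *)
  (forall (U V : set 'M[R]_n) (L L' : {linear 'M[R]_n -> eigen_space R n}),
    eigenpair_cone U -> eigenpair_cone V -> U <> V ->
    represented_on U L -> represented_on V L' -> ~ (L =1 L'))
  /\
  (forall U : set 'M[R]_n, eigenpair_cone U -> iso_std_cone U)
  /\
  set_bij [set phi : {ffun 'I_n -> 'I_n} | connected_fun phi]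
    (@eigenpair_cone R n) (@cone_of_fun R n)
  /\
  (exists N : nat,
    (@eigenpair_cone R n #= `I_N)%card /\
    (N%:R : rat) =
      \sum_(1 <= k < n.+1)
        (n`!%:R / (n - k)`!%:R) * (n%:R : rat) ^ (n%:Z - k%:Z - 1))
  /\
  ((3 <= n)%N ->
    exists U V : set 'M[R]_n,
      [/\ eigenpair_cone U, eigenpair_cone V &
        ~ (face (closure U) (closure U `&` closure V) /\
           face (closure V) (closure U `&` closure V))]).
Proof.
have bij : set_bij [set phi : {ffun 'I_n -> 'I_n} | connected_fun phi]
    (@eigenpair_cone R n) (@cone_of_fun R n).
  split=> [phi conn|phi psi|U /(eigenpair_coneP _ hn)[phi conn <-]].
  - exact: cone_of_fun_maximal.
  - rewrite !inE /= => conn _ E.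
    apply: (cone_of_fun_inj hn conn (fun_mx_cone R phi)).
    by rewrite -E; apply: fun_mx_cone.
  - by exists phi.
split; [|split; [|split; [|split; [|split]]]].
- move=> U [[[U0 Uo _] [L LU]] _]; exists L; split=> // L' LU'.
  by apply: linear_eq_open U0 _ => // A UA; apply/(LU _ UA)/(LU' _ UA).
- move=> U V L L' Uc Vc UV LU LV LL.
  exact/UV/(eigenpair_cone_fun_inj Uc Vc LU LV LL).
- by move=> U /(eigenpair_coneP _ hn)[phi conn <-]; apply: cone_of_fun_iso.
- exact: bij.
- exists #|[set phi | @connected_fun n phi]%SET|; split; last exact: card_connected_fun.
  apply: (card_eq_trans (B := [set phi : {ffun 'I_n -> 'I_n} | connected_fun phi])).
    by rewrite card_eq_sym; apply/card_set_bijP; exists (@cone_of_fun R n).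
  apply/card_set_bijP; pose s := enum [set phi | @connected_fun n phi]%SET.
  have sP phi : (phi \in s) = connected_fun phi by rewrite mem_enum inE.
  exists (fun phi => index phi s); split=> [phi|phi psi|k].
  + by rewrite /= cardE index_mem sP.
  + by rewrite !inE /= -!sP => phis psis; apply: index_inj.
  + rewrite /= cardE => ks.
    (* Only a default for [nth]: [k] is below the length of [s]. *)
    pose phi0 : {ffun 'I_n -> 'I_n} := [ffun i => i].
    exists (nth phi0 s k); first by rewrite /= -sP mem_nth.
    by rewrite index_uniq ?enum_uniq.
- move=> n3; have n1 : (1 < n)%N by apply: ltnW.
  pose i0 := Ordinal hn; pose i1 := Ordinal n1; pose i2 := Ordinal n3.
  exists (@cone_of_fun R n [ffun=> i0]), (@cone_of_fun R n [ffun=> i1]); split.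
  + by apply: cone_of_fun_maximal => //; apply: connected_const.
  + by apply: cone_of_fun_maximal => //; apply: connected_const.
  + by case=> + _; apply: (@const_cones_not_face _ _ i0 i1 i2).
Qed.
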